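(* For the transcendental numbers $\pi$ and $e$ and all $x>0$, $$D^e(x^\pi)=\frac{\Gamma(\pi+1)}{\Gamma(\pi-e+1)}x^{\pi-e},\qquad D^\pi(x^e)=\frac{\Gamma(e+1)}{\Gamma(e-\pi+1)}x^{e-\pi},$$ and the product $$D^e(x^\pi)\cdot D^\pi(x^e)=\frac{\Gamma(\pi+1)\,\Gamma(e+1)}{\Gamma(\pi-e+1)\,\Gamma(e-\pi+1)}$$ is independent of $x$.
   Context: For a real number $r>0$, the $r$-order integral operator $J^r$ is defined by $$J^r(f)(x)=\frac{1}{\Gamma(r)}\int_0^x (x-y)^{r-1}f(y)\,dy,\qquad x>0,$$ where $\Gamma$ is Euler's gamma function. For a positive integer $k$, $D^k$ is the ordinary $k$-th derivative with respect to $x$. For a real number $s>0$, $D^s$ is defined by choosing an integer $k>s$ and setting $D^s(f)(x)=D^kJ^{k-s}(f)(x)$ (the claim is to hold for every such choice of $k$). $D^s(x^p)$ denotes the value at $x$ of $D^s$ applied to the function $f(x)=x^p$; the product in the claim is the pointwise product of the two function values at $x$. *)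

(* Defs.v *)
From HB Require Import structures.
From mathcomp Require Import all_boot all_order all_algebra.
From mathcomp Require Import all_classical all_reals all_analysis.

Set Implicit Arguments.
Unset Strict Implicit.
Unset Printing Implicit Defensive.

Import Order.TTheory GRing.Theory Num.Theory.
Import numFieldNormedType.Exports.

Local Open Scope classical_set_scope.
Local Open Scope ring_scope.

(* Euler's integral, meaningful only for a > 0: for a <= 0 the integral
   diverges and [Rintegral] returns 0. *)
Definition Gamma (R : realType) (a : R) : R :=
  (\int[@lebesgue_measure R]_(t in `[0%R, +oo[) (t `^ (a - 1) * expR (- t)))%R.

(* Integrand of J^r(f)(x). When r < 1 the kernel is singular at y = x; the
   value [0 `^ (r - 1)] there only matters on a null set. *)
Definition RL_integrand (R : realType) (r : R) (f : R -> R) (x y : R) : R :=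
  (x - y) `^ (r - 1) * f y.

(* J^r(f)(x), intended for r > 0 and x > 0. *)
Definition RL_integral (R : realType) (r : R) (f : R -> R) (x : R) : R :=
  (Gamma r)^-1 *
  (\int[@lebesgue_measure R]_(y in `[0%R, x]) RL_integrand r f x y)%R.

(* D^s(f)(x) = D^k J^(k-s)(f)(x), for an integer k > s. *)
Definition RL_deriv (R : realType) (k : nat) (s : R) (f : R -> R) (x : R) : R :=
  ((RL_integral (k%:R - s) f)^`(k))%classic x.

(* [Rintegral] and [derive1n] are total functions. This predicate says that
   D^k J^(k-s)(f) really exists on ]0, +oo[: the integral converges and can be
   differentiated k times. *)
Definition RL_derivable (R : realType) (k : nat) (s : R) (f : R -> R) : Prop :=
  forall x : R, 0 < x ->
    (@lebesgue_measure R).-integrable `[0%R, x]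
      (fun y => (RL_integrand (k%:R - s) f x y)%:E) /\
    (forall j : nat, (j < k)%N ->
      derivable ((RL_integral (k%:R - s) f)^`(j))%classic x 1).

(* Main.v *)
(** Writing [ppow a t] for [t `^ (a - 1)] extended by [0] to [t <= 0], Tonelli
    and a translation give
    [Gamma a * Gamma b = B(a, b) * Gamma (a + b)], with
    [B(a, b) u^(a+b-1) = \int_0^u t^(a-1) (u - t)^(b-1) dt] by scaling. All of
    this holds in the extended reals, before any convergence is known. The case
    [b = 1] is the recurrence [Gamma (a + 1) = a * Gamma a], which also yields
    the convergence of Gamma: first at integers, then by comparison.
    Hence [J^r(x^p) = Gamma (p + 1) / Gamma (p + r + 1) * x^(p + r)], and the
    recurrence turns [k] ordinary derivatives into a shift of [p + r] by [k], as
    long as [p + r - k + 1 > 0]. In the two cases at hand this needs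
    [|pi - e| < 1], which follows from [5/2 < e < 3] and [2 <= pi < 7/2]. *)

Require Import Defs.
From HB Require Import structures.
From mathcomp Require Import all_boot all_order all_algebra.
From mathcomp Require Import all_classical all_reals all_analysis.
From mathcomp Require Import measurable_realfun ring lra.

Import Order.TTheory GRing.Theory Num.Theory.
Import numFieldNormedType.Exports.

Local Open Scope classical_set_scope.
Local Open Scope ring_scope.

Section eulerian.
Context {R : realType}.
Notation mu := (@lebesgue_measure R).

(** * Affine substitution; Gamma and Beta integrals in the extended reals *)

(** By uniqueness of Lebesgue measure: [c] times its pushforward under [x |-> c * x + d] gives each
    half-open interval its length. *)
Lemma ge0_integral_affine (c d : R) (f : R -> \bar R) : 0 < c ->
  measurable_fun [set: R] f -> (forall x, (0 <= f x)%E) ->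
  (\int[mu]_x f x = c%:E * \int[mu]_x f (c * x + d)%R)%E.
Proof.
move=> c0 mf f0.
pose phi : measurableTypeR R -> measurableTypeR R := fun x => c * x + d.
have mphi : measurable_fun setT phi.
  by apply: measurable_funD => //; exact: measurable_funM.
pose cn : {nonneg R} := NngNum (ltW c0).
pose nu : {measure set (measurableTypeR R) -> \bar R} :=
  mscale cn (pushforward mu phi).
have E A : measurable A -> mu A = nu mphi A.
  apply: lebesgue_measure_unique => _ [[a b]] /= _ <-.
  have pre : phi @^-1` `]a, b]%classic = `](a - d) / c, (b - d) / c]%classic.
    apply/seteqP; split => x; rewrite /= !in_itv /= /phi;
      by rewrite ltr_pdivrMr// ler_pdivlMr// ltrBlDr lerBrDr mulrC.
  transitivity (c%:E * mu (phi @^-1` `]a, b]%classic))%E; last by [].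
  rewrite pre.
  rewrite !lebesgue_measure_itv/= !lte_fin ltr_pM2r ?invr_gt0// ltrD2r.
  case: ifPn => _; last by rewrite mule0.
  by rewrite -!EFinB -EFinM; congr EFin; field; rewrite gt_eqF.
transitivity (\int[nu mphi]_x f x)%E.
  by apply: eq_measure_integral => A mA _; exact: E.
rewrite ge0_integral_mscale//= ge0_integral_pushforward//.
Qed.

(* The cutoff at [0] makes the convolution [eBeta a b u] an integral over [0, u]. *)
Definition ppow (a t : R) : R := if 0 < t then t `^ (a - 1) else 0.

Lemma ppow_ge0 a t : 0 <= ppow a t.
Proof. by rewrite /ppow; case: ifP => // _; exact: powR_ge0. Qed.

Lemma measurable_ppow a : measurable_fun [set: R] (ppow a).
Proof.
apply: measurable_fun_ifT => //.
exact: measurable_fun_ltr.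
Qed.

Lemma ppowM a c t : 0 < c -> ppow a (c * t) = c `^ (a - 1) * ppow a t.
Proof.
move=> c0; rewrite /ppow pmulr_rgt0//; case: ifPn => [t0|_]; last by rewrite mulr0.
by rewrite powRM// ltW.
Qed.

Lemma ppow1 t : ppow 1 t = (0 < t)%R%:R.
Proof. by rewrite /ppow subrr powRr0; case: ifP. Qed.

Definition eGamma (a : R) : \bar R := (\int[mu]_t (ppow a t * expR (- t))%:E)%E.

Definition eBeta (a b : R) (u : R) : \bar R :=
  (\int[mu]_t (ppow a t * ppow b (u - t))%:E)%E.

Lemma measurable_eGamma_integrand a :
  measurable_fun [set: R] (fun t => (ppow a t * expR (- t))%:E).
Proof.
apply/measurable_EFinP; apply: measurable_funM; first exact: measurable_ppow.
exact: measurableT_comp.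
Qed.

Lemma measurable_eBeta_integrand a b u :
  measurable_fun [set: R] (fun t => (ppow a t * ppow b (u - t))%:E).
Proof.
apply/measurable_EFinP; apply: measurable_funM; first exact: measurable_ppow.
apply: (measurableT_comp (measurable_ppow b)).
exact: measurable_funB.
Qed.

Lemma eGamma_ge0 a : (0 <= eGamma a)%E.
Proof.
by apply: integral_ge0 => t _; rewrite lee_fin mulr_ge0 ?ppow_ge0 ?expR_ge0.
Qed.

Lemma eBeta_ge0 a b u : (0 <= eBeta a b u)%E.
Proof. by apply: integral_ge0 => t _; rewrite lee_fin mulr_ge0 ?ppow_ge0. Qed.

(** Substitute [t = u * s]: the Jacobian and the two homogeneous factors contribute
    [u * u^(a-1) * u^(b-1) = u^(a+b-1)]. For [u <= 0] the two cutoffs are never both passed, so both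
    sides vanish. *)
Lemma eBeta_scale a b u : eBeta a b u = ((ppow (a + b) u)%:E * eBeta a b 1)%E.
Proof.
have [u0|u0] := ltP 0 u; last first.
  rewrite [ppow _ u]/ppow ltNge u0/= mul0e /eBeta integral0_eq// => t _.
  congr EFin; rewrite /ppow; case: ltP => t0; last by rewrite mul0r.
  by rewrite subr_gt0 ltNge (le_trans u0 (ltW t0)) mulr0.
rewrite /eBeta (@ge0_integral_affine u 0)//=; last 2 first.
- exact: measurable_eBeta_integrand.
- by move=> t; rewrite lee_fin mulr_ge0 ?ppow_ge0.
transitivity (u%:E * \int[mu]_t ((u `^ (a - 1) * u `^ (b - 1))%:E *
    (ppow a t * ppow b (1 - t))%:E))%E.
  congr (_ * _)%E; apply: eq_integral => t _; rewrite -EFinM; congr EFin.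
  rewrite addr0 ppowM// (_ : u - u * t = u * (1 - t)); last by ring.
  by rewrite ppowM//; ring.
rewrite ge0_integralZl//; last 3 first.
- exact: measurable_eBeta_integrand.
- by move=> t _; rewrite lee_fin mulr_ge0 ?ppow_ge0.
- by rewrite lee_fin mulr_ge0 ?powR_ge0.
rewrite muleA -EFinM; congr (_%:E * _)%E.
have u1 : u != 0 by rewrite gt_eqF.
rewrite /ppow u0 -[X in X * _](@powRr1 _ u) ?ltW//.
by rewrite -!powRD ?u1 ?implybT//; congr (_ `^ _); ring.
Qed.

Lemma eGamma_mul a b : (eGamma a * eGamma b = eBeta a b 1 * eGamma (a + b))%E.
Proof.
pose F (x : R * R) : \bar R :=
  (ppow a x.1 * ppow b (x.2 - x.1) * expR (- x.2))%:E.
have mF : measurable_fun setT F.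
  apply/measurable_EFinP; apply: measurable_funM; last first.
    by do 2 apply: measurableT_comp => //.
  apply: measurable_funM.
    exact: (measurableT_comp (measurable_ppow a)).
  by apply: (measurableT_comp (measurable_ppow b)); exact: measurable_funB.
have F0 x : (0 <= F x)%E.
  by rewrite lee_fin !mulr_ge0 ?ppow_ge0 ?expR_ge0.
transitivity (\int[mu]_t \int[mu]_u F (t, u))%E.
  rewrite muleC {2}/eGamma -ge0_integralZl//; last 3 first.
  - exact: measurable_eGamma_integrand.
  - by move=> t _; rewrite lee_fin mulr_ge0 ?ppow_ge0 ?expR_ge0.
  - exact: eGamma_ge0.
  (* For fixed [t], shift the variable of the second factor: [s = u - t]. *)
  apply: eq_integral => t _.
  rewrite muleC /eGamma (@ge0_integral_affine 1 (- t))//=; last 2 first.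
  - exact: measurable_eGamma_integrand.
  - by move=> s; rewrite lee_fin mulr_ge0 ?ppow_ge0 ?expR_ge0.
  rewrite mul1e -ge0_integralZl//; last 3 first.
  - apply: (measurableT_comp (measurable_eGamma_integrand b)).
    by apply: measurable_funD => //; exact: measurable_funM.
  - by move=> s _; rewrite lee_fin mulr_ge0 ?ppow_ge0 ?expR_ge0.
  - by rewrite lee_fin mulr_ge0 ?ppow_ge0 ?expR_ge0.
  apply: eq_integral => u _; rewrite /F -EFinM; congr EFin => /=.
  rewrite mul1r (_ : expR (- u) = expR (- t) * expR (- (u - t))); last first.
    by rewrite -expRD; congr expR; ring.
  by ring.
rewrite fubini_tonelli//.
(* With the order exchanged, the inner integral over [t] is [expR (- u) * eBeta a b u], and scaling
   isolates the constant [eBeta a b 1]. *)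
transitivity (\int[mu]_u (eBeta a b 1 * (ppow (a + b) u * expR (- u))%:E))%E.
  apply: eq_integral => u _.
  transitivity ((expR (- u))%:E * eBeta a b u)%E; last first.
    by rewrite eBeta_scale muleA -EFinM muleC; congr (_ * _%:E)%E; ring.
  rewrite /eBeta -ge0_integralZl//; last 2 first.
  - exact: measurable_eBeta_integrand.
  - by move=> t _; rewrite lee_fin mulr_ge0 ?ppow_ge0.
  by apply: eq_integral => t _; rewrite /F -EFinM; congr EFin => /=; ring.
rewrite ge0_integralZl//.
- exact: measurable_eGamma_integrand.
- by move=> t _; rewrite lee_fin mulr_ge0 ?ppow_ge0 ?expR_ge0.
- exact: eBeta_ge0.
Qed.

(** * Special values, recurrence and convergence *)

(** The integrand may be singular at 0, so the fundamental theorem of calculus is applied away from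
    0 and monotone convergence gives the limit. *)
Lemma integral_powR01 (a : R) : 0 < a ->
  (\int[mu]_(t in `]0%R, 1%R]) (t `^ (a - 1))%:E = (a^-1)%:E)%E.
Proof.
move=> a0.
(* The shift [n.+2] keeps the left endpoint strictly below 1, as the fundamental theorem
   requires. *)
pose F n : set R := `[n.+2%:R^-1, 1]%classic.
have n2 n : 0 < n.+2%:R^-1 :> R by rewrite invr_gt0.
have UF : `]0%R, 1%R]%classic = \bigcup_n F n.
  apply/seteqP; split => x /=.
    rewrite in_itv/= => /andP[x0 x1]; exists (Num.truncn x^-1) => //.
    rewrite /F /= in_itv/= x1 andbT invf_ple ?posrE//.
    apply/ltW/(lt_le_trans (truncnS_gt _)).
    by rewrite ler_nat.
  move=> [n _]; rewrite /F /= !in_itv/= => /andP[h ->]; rewrite andbT.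
  exact: lt_le_trans h.
have I n : (\int[mu]_(t in F n) (t `^ (a - 1))%:E =
    (a^-1 * (1 - n.+2%:R^-1 `^ a))%:E)%E.
  have dF (x : R) : 0 < x ->
      is_derive x 1 (fun t => a^-1 * t `^ a) (x `^ (a - 1)).
    move=> x0; have h := is_derive1_powR a x0.
    rewrite -[x `^ (a - 1)](@mulKf _ a) ?gt_eqF//.
    exact: is_deriveZ.
  have cF (x : R) : 0 < x -> {for x, continuous (fun t => a^-1 * t `^ a)}.
    move=> x0; apply: differentiable_continuous.
    by apply/derivable1_diffP; have [] := dF x x0.
  rewrite (@continuous_FTC2 _ _ (fun t => a^-1 * t `^ a)).
  - by rewrite powR1 -EFinB; congr EFin; ring.
  - by rewrite invf_lt1// ltr1n.
  - apply/continuous_in_subspaceT => x; rewrite inE/= in_itv/= => /andP[h _].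
    have x0 : 0 < x by exact: lt_le_trans h.
    apply: differentiable_continuous; apply/derivable1_diffP.
    by apply: derivable_powR; rewrite in_itv/= x0.
  - split.
    + move=> x; rewrite in_itv/= => /andP[h _].
      by have [] := dF x (lt_trans (n2 n) h).
    + exact/cvg_at_right_filter/cF.
    + exact/cvg_at_left_filter/cF.
  - move=> x; rewrite in_itv/= => /andP[h _].
    by rewrite derive1E; have [] := dF x (lt_trans (n2 n) h).
have H : (\int[mu]_(t in F i) (t `^ (a - 1))%:E @[i --> \oo] -->
    \int[mu]_(t in \bigcup_i F i) (t `^ (a - 1))%:E)%E.
  apply: ge0_nondecreasing_set_cvg_integral.
  - apply/nondecreasing_seqP => n; rewrite subsetEset /F; apply: subset_itvr.
    by rewrite bnd_simp lef_pV2 ?posrE// ler_nat.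
  - by move=> n; exact: measurable_itv.
  - by move=> n; apply/measurable_EFinP; exact: measurable_funTS.
  - by move=> n x _; rewrite lee_fin powR_ge0.
rewrite UF; apply: (cvg_unique _ H) => //=; rewrite (funext I).
apply: cvg_EFin; first by near=> n.
suff h : (1 - n.+2%:R^-1 `^ a) @[n --> \oo] --> (1 : R).
  by rewrite -[X in _ --> X]mulr1; exact: cvgMl_tmp.
rewrite -[X in _ --> X]subr0; apply: cvgB; first exact: cvg_cst.
(* The endpoints tend to 0 from the right, where [t^a] tends to 0 because [a > 0]. *)
have c2 : (fun n : nat => n.+2%:R^-1 : R) @ \oo --> 0^'+.
  move=> A hA; have := @cvg_harmonic R; rewrite -cvg_shiftS => /(_ _ hA).
  by move=> [N _ HN]; exists N => // n /= Nn; exact: HN _ Nn (n2 n).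
exact: cvg_comp c2 (@powR_cvg0 R a a0).
Unshelve. all: by end_near. Qed.

Lemma eBeta1r (a : R) : 0 < a -> eBeta a 1 1 = (a^-1)%:E.
Proof.
move=> a0; rewrite -integral_powR01// -integral_itv_bndo_bndc; last first.
  by apply/measurable_EFinP; exact: measurable_funTS.
rewrite integral_mkcond/=; apply: eq_integral => t _.
rewrite patchE mem_setE in_itv/= ppow1 subr_gt0 /ppow.
case: (ltP 0 t) => _; case: (ltP t 1) => _ //=; rewrite ?mul0r ?mulr1 ?mulr0//.
Qed.

(** This is the total mass of the exponential density of rate 1. *)
Lemma eGamma1 : eGamma 1 = 1%E.
Proof.
rewrite -(@integral_exponential_pdf R 1)//.
transitivity (\int[mu]_(t in `]0%R, +oo[) (expR (- t))%:E)%E.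
  rewrite [RHS]integral_mkcond; apply: eq_integral => t _.
  rewrite patchE mem_setE in_itv/= andbT ppow1.
  by case: (ltP 0 t) => _; rewrite ?mul1r ?mul0r.
rewrite integral_itv_obnd_cbnd; last first.
  by apply/measurable_EFinP/measurable_funTS/measurableT_comp.
rewrite integral_mkcond; apply: eq_integral => t _.
rewrite /exponential_pdf !patchE; case: ifP => // _.
by rewrite mul1r mulN1r.
Qed.

Lemma eGammaS (a : R) : 0 < a -> eGamma (a + 1) = (a%:E * eGamma a)%E.
Proof.
move=> a0; have := eGamma_mul a 1.
rewrite eGamma1 mule1 eBeta1r// => ->.
by rewrite muleA -EFinM divff ?gt_eqF// mul1e.
Qed.

Lemma eGamma_nat n : eGamma n.+1%:R \is a fin_num.
Proof.
elim: n => [|n ih]; first by rewrite eGamma1.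
by rewrite -natr1 eGammaS// fin_numM.
Qed.

(* [t^a <= 1 + t^n] for an integer [n >= a] bounds [eGamma (a + 1)]. *)
Lemma eGamma_fin (a : R) : 0 < a -> eGamma a \is a fin_num.
Proof.
move=> a0.
(* The recurrence can be divided by [a]; at [a + 1] the exponent is positive, so the integrand has
   no singularity at 0. *)
suff : eGamma (a + 1) \is a fin_num.
  rewrite eGammaS// => h.
  rewrite -[eGamma a]mul1e -(@mulVf _ a) ?gt_eqF// EFinM -muleA.
  exact: fin_numM.
have [n an] : exists n, a <= n%:R.
  by exists (Num.truncn a).+1; rewrite ltW// truncnS_gt.
rewrite ge0_fin_numE ?eGamma_ge0//.
apply: (@le_lt_trans _ _ (eGamma 1 + eGamma n.+1%:R)%E); last first.
  by rewrite eGamma1 lte_add_pinfty ?ltry// -ge0_fin_numE ?eGamma_ge0 ?eGamma_nat.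
rewrite /eGamma -ge0_integralD//; last 4 first.
- by move=> t _; rewrite lee_fin mulr_ge0 ?ppow_ge0 ?expR_ge0.
- exact: measurable_eGamma_integrand.
- by move=> t _; rewrite lee_fin mulr_ge0 ?ppow_ge0 ?expR_ge0.
- exact: measurable_eGamma_integrand.
apply: ge0_le_integral => //.
- by move=> t _; rewrite lee_fin mulr_ge0 ?ppow_ge0 ?expR_ge0.
- exact: measurable_eGamma_integrand.
- apply: emeasurable_funD; exact: measurable_eGamma_integrand.
move=> t _; rewrite -EFinD lee_fin -mulrDl ler_wpM2r ?expR_ge0//.
rewrite ppow1 /ppow; case: ltP => t0; last by rewrite addr0.
rewrite -natr1 !addrK.
have [t1|t1] := leP t 1.
  rewrite -[leLHS]addr0 lerD ?powR_ge0//.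
  have <- : 1 `^ a = 1 :> R by rewrite powR1.
  by rewrite ge0_ler_powR ?nnegrE// ltW.
rewrite -[leLHS]add0r lerD//.
by rewrite ler_powR// ltW.
Qed.

(** * The real-valued Gamma function *)

(** The two integrals differ only at the null point 0, so they agree whether or not they
    converge. *)
Lemma GammaE (a : R) : Gamma a = fine (eGamma a).
Proof.
rewrite /Gamma /Rintegral /eGamma; congr fine.
have m (D : set R) : measurable_fun D (fun t : R => (t `^ (a - 1) * expR (- t))%:E).
  apply/measurable_EFinP; apply: measurable_funTS; apply: measurable_funM => //.
  exact: measurableT_comp.
rewrite -integral_itv_obnd_cbnd// integral_mkcond.
apply: eq_integral => t _; rewrite patchE /ppow mem_setE in_itv/= andbT.
by case: ifP => // _; rewrite mul0r.
Qed.

(** By the recurrence it is enough to look at [a + 1], where the integrand [t^a * expR (- t)] is at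
    least [expR (- 2)] on [[1, 2]]. *)
Lemma Gamma_gt0 (a : R) : 0 < a -> 0 < Gamma a.
Proof.
move=> a0; rewrite GammaE.
suff H : (0 < eGamma (a + 1))%E.
  rewrite fine_gt0//; apply/andP; split; last first.
    by rewrite -ge0_fin_numE ?eGamma_ge0// eGamma_fin.
  move: H; rewrite eGammaS// !lt0e => /andP[+ _]; rewrite eGamma_ge0 andbT.
  by apply: contra => /eqP ->; rewrite mule0.
apply: (@lt_le_trans _ _ (\int[mu]_(t in `[1%R, 2%R]) (expR (- 2))%:E)%E).
  rewrite integral_cst//= lebesgue_measure_itv/= lte_fin ltr1n/=.
  by rewrite -EFinB -EFinM lte_fin mulr_gt0 ?expR_gt0//; lra.
rewrite /eGamma integral_mkcond; apply: ge0_le_integral => //.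
- by move=> t _; rewrite patchE; case: ifP; rewrite ?lee_fin ?expR_ge0.
- apply/(measurable_restrictT _ _).1 => //; exact: measurable_cst.
- exact: measurable_eGamma_integrand.
move=> t _; rewrite patchE mem_setE in_itv/=; case: ifPn; last first.
  by move=> _; rewrite lee_fin mulr_ge0 ?ppow_ge0 ?expR_ge0.
move=> /andP[t1 t2]; rewrite lee_fin /ppow (lt_le_trans _ t1)// addrK.
rewrite -[leLHS]mul1r ler_pM ?expR_ge0//.
  have <- : 1 `^ a = 1 :> R by rewrite powR1.
  by rewrite ge0_ler_powR ?nnegrE// ?(le_trans _ t1)// ltW.
by rewrite ler_expR lerN2.
Qed.

Lemma GammaS (a : R) : 0 < a -> Gamma (a + 1) = a * Gamma a.
Proof. by move=> a0; rewrite !GammaE eGammaS// fineM// eGamma_fin. Qed.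

Lemma Beta_Gamma (a b : R) : 0 < a -> 0 < b ->
  eBeta a b 1 = (Gamma a * Gamma b / Gamma (a + b))%:E.
Proof.
move=> a0 b0; have ab0 : 0 < a + b by rewrite addr_gt0.
have := eGamma_mul a b.
rewrite -(fineK (eGamma_fin _ a0)) -(fineK (eGamma_fin _ b0)).
rewrite -(fineK (eGamma_fin _ ab0)) -!GammaE => h.
have G0 := Gamma_gt0 _ ab0.
rewrite EFinM [X in (_ = X * _)%E]EFinM h -muleA -EFinM divff ?gt_eqF//.
by rewrite mule1.
Qed.

(** * The fractional integral of a power as a Beta integral *)

Lemma RL_integrand_powR (r p x : R) : 0 < r -> 0 < p -> 0 < x ->
  (\int[mu]_(y in `[0%R, x]) (RL_integrand r (fun y => y `^ p) x y)%:E =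
   (Gamma r * Gamma (p + 1) / Gamma (p + 1 + r) * x `^ (p + r))%:E)%E.
Proof.
move=> r0 p0 x0.
have p1 : 0 < p + 1 by lra.
have := eBeta_scale (p + 1) r x.
rewrite Beta_Gamma// /ppow x0 -EFinM.
rewrite (_ : p + 1 + r - 1 = p + r); last by ring.
rewrite [_ * (_ / _)]mulrC (mulrC (Gamma r)) => <-.
(* Dropping both endpoints, a null set, matches the strict cutoffs of [ppow]. *)
rewrite (@integral_itv_bndoo _ _ _ _ true false); last first.
  apply/measurable_EFinP/measurable_funTS/measurable_funM => //.
  by apply: (measurableT_comp (@measurable_powR R (r - 1))); exact: measurable_funB.
rewrite integral_mkcond; apply: eq_integral => t _.
rewrite patchE mem_setE in_itv/= /RL_integrand /ppow addrK subr_gt0.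
case: (ltP 0 t) => _; case: (ltP t x) => _ //=; rewrite ?mul0r ?mulr0//.
by rewrite mulrC.
Qed.

End eulerian.

(** * Numerical bounds on e and pi *)

(** The eighth power of [1 + x <= expR x] at [x = 1/8] suffices: [(9/8)^8 > 5/2]. *)
Lemma expR1_gt52 (R : realType) : 5 / 2 < expR 1 :> R.
Proof.
have h : 1 + 8^-1 <= expR (8^-1) :> R by exact: expR_ge1Dx.
have -> : expR 1 = expR (8^-1) ^+ 8 :> R.
  by rewrite -expRM_natr mulVf.
apply: (@lt_le_trans _ _ ((1 + 8^-1) ^+ 8)); first by lra.
by rewrite lerXn2r ?nnegrE ?expR_ge0//; lra.
Qed.

(** The same inequality at [x = -1/6] bounds the inverse: [(5/6)^6 > 1/3]. *)
Lemma expR1_lt3 (R : realType) : expR 1 < 3 :> R.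
Proof.
have h : 1 + - 6^-1 <= expR (- 6^-1) :> R by exact: expR_ge1Dx.
have -> : expR 1 = (expR (- 6^-1) ^+ 6)^-1 :> R.
  by rewrite -expRM_natr -expRN mulNr opprK mulVf.
rewrite invf_plt ?posrE ?exprn_gt0 ?expR_gt0//.
apply: (@lt_le_trans _ _ ((1 + - 6^-1) ^+ 6)); first by lra.
by rewrite lerXn2r ?nnegrE ?expR_ge0//; lra.
Qed.

(** The first three terms of the cosine series, [1 - x^2/2 + x^4/24], are already negative at
    [x = 7/4]; the remaining terms, taken in consecutive pairs, only lower the sum. *)
Lemma cos74_lt0 (R : realType) : cos (7 / 4) < 0 :> R.
Proof.
rewrite -(opprK (cos _)) oppr_lt0; have /cvgN h := @cvg_cos_coeff' R (7 / 4).
rewrite -(cvg_lim (@Rhausdorff R) h).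
apply: (@lt_trans _ _ (\sum_(0 <= i < 3) - cos_coeff' (7 / 4) i)).
  do 3 rewrite big_nat_recl//; rewrite big_nil addr0.
  rewrite /cos_coeff' /= expr0z expr1z -exprnP.
  have -> : (0.*2)`! = 1%N by [].
  have -> : (1.*2)`! = 2%N by [].
  have -> : (2.*2)`! = 24%N by [].
  by rewrite /double/=; lra.
rewrite -seriesN lt_sum_lim_series //.
  by move/cvgP in h; by rewrite seriesN.
move=> d.
rewrite /cos_coeff' 2!exprzD_nat (exprSz _ d.*2) -[in (-1) ^ d.*2](muln2 d).
rewrite -(exprnP _ (d * 2)) (exprM (-1)) sqrr_sign 2!mulr1 -exprSzr.
rewrite [(-1) ^ 3](_ : _ = -1) ?mulN1r ?mulNr ?opprK; last first.
  by rewrite -exprnP 2!exprS expr1 mulrN1 opprK mulr1.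
rewrite [(-1) ^ 4](_ : _ = 1); last by rewrite -exprnP; ring.
rewrite mul1r subr_gt0 addnS doubleS.
have : (0 < (3 + d.*2).*2)%N by rewrite addSn doubleS.
move: (3 + d.*2).*2 => n n0.
rewrite factS factS 2!natrM (exprD _ 2 n : _ ^+ n.+2 = _).
have p0 : 0 < (7 / 4 : R) ^+ n by rewrite exprn_gt0//; lra.
have f0 : 0 < n`!%:R :> R by rewrite ltr0n fact_gt0.
have n1 : 2 <= n.+1%:R :> R by rewrite ler_nat ltnS.
have n2 : 2 <= n.+2%:R :> R by rewrite ler_nat.
move: (_ ^+ n) (n`!%:R) (n.+1%:R) (n.+2%:R) p0 f0 n1 n2 => P N a b P0 N0 a2 b2.
have ab : 0 < b * a by nra.
rewrite mulrA (mulrC (_ ^+ 2)) -!mulrA invfM mulrA.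
(* The ratio of consecutive terms in a pair is below 1, since [(7/4)^2 < 4 <= b * a]. *)
rewrite [ltLHS](_ : _ = P / N * ((7 / 4) ^+ 2 / (b * a))); last first.
  by field; rewrite !gt_eqF//; lra.
rewrite gtr_pMr ?divr_gt0// ltr_pdivrMr// mul1r.
by nra.
Qed.

(** If [pi / 2 >= 7/4], then [cos (7/4)] would be nonnegative. *)
Lemma pi_lt72 (R : realType) : pi < 7 / 2 :> R.
Proof.
suff : pi / 2 < 7 / 4 :> R by lra.
rewrite ltNge; apply/negP; rewrite le_eqVlt => /orP[/eqP h|h].
  by have := @cos74_lt0 R; rewrite h cos_pihalf ltxx.
have := @cos74_lt0 R; apply/negP; rewrite -leNgt ltW// cos_gt0_pihalf//.
by rewrite h andbT; have := @pi_gt0 R; lra.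
Qed.

(** * Iterated derivatives and the fractional derivative of a power *)

(** Each derivative brings down the factor [q - j], which the recurrence
    [G (q - j + 1) = (q - j) * G (q - j)] absorbs. *)
Lemma derive1n_powR (R : realType) (f G : R -> R) (c q : R) (k : nat) :
  (forall x : R, 0 < x -> f x = c / G (q + 1) * x `^ q) ->
  (forall z : R, 0 < z -> G (z + 1) = z * G z) ->
  (forall z : R, 0 < z -> 0 < G z) ->
  0 < q - k%:R + 1 ->
  forall j, (j <= k)%N -> forall x : R, 0 < x ->
    ((f^`(j))%classic x = c / G (q - j%:R + 1) * x `^ (q - j%:R)) /\
    ((j < k)%N -> derivable (f^`(j))%classic x 1).
Proof.
move=> fE GS G0 qk.
pose g j x := c / G (q - j%:R + 1) * x `^ (q - j%:R).
have dg j (x : R) : 0 < x ->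
    is_derive x 1 (g j) (c / G (q - j%:R + 1) * ((q - j%:R) * x `^ (q - j%:R - 1))).
  move=> x0; rewrite /g; have h := is_derive1_powR (q - j%:R) x0.
  exact: is_deriveZ.
(* The formulas hold only for positive arguments; this set is open, so they can still be
   differentiated there. *)
have ng (h1 h2 : R -> R) (x : R) : (forall y : R, 0 < y -> h1 y = h2 y) -> 0 < x ->
    \forall y \near x, h1 y = h2 y.
  by move=> H x0; near=> y; apply: H; near: y; exact: lt_nbhsr.
suff H j : (j <= k)%N -> forall x : R, 0 < x -> (f^`(j))%classic x = g j x.
  move=> j jk x x0; split; first exact: H.
  move=> _; apply: (@near_eq_derivable _ _ _ (g j)) => //.
    by apply: ng x0 => y y0; apply/esym/H.
  by have [] := dg j x x0.
elim: j => [_ x x0|j ih jk x x0].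
  by rewrite derive1n0 fE// /g subr0.
rewrite derive1nS derive1E (@near_eq_derive _ _ _ _ (g j))//; last first.
  by apply: ng x0 => y y0; apply: ih => //; exact: ltnW.
have [_ ->] := dg j x x0.
(* From [j + 1 <= k], [q - j >= q - k + 1 > 0]: the recurrence is used at positive arguments
   only. *)
have qj : 0 < q - j%:R.
  have : j.+1%:R <= k%:R :> R by rewrite ler_nat.
  by rewrite -natr1; lra.
have -> : q - j%:R - 1 = q - j.+1%:R by rewrite -natr1; ring.
rewrite /g GS// -natr1 (_ : q - (j%:R + 1) + 1 = q - j%:R); last by ring.
have Gq : G (q - j%:R) != 0 by rewrite gt_eqF ?G0.
field; rewrite Gq. by rewrite gt_eqF.
Unshelve. all: end_near. Qed.

Lemma RL_integral_powR (R : realType) (r p x : R) : 0 < r -> 0 < p -> 0 < x ->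
  RL_integral r (fun y => y `^ p) x =
  Gamma (p + 1) / Gamma (p + r + 1) * x `^ (p + r).
Proof.
move=> r0 p0 x0; rewrite /RL_integral /Rintegral RL_integrand_powR//=.
have := Gamma_gt0 _ r0; have : 0 < p + 1 + r by lra.
move=> /Gamma_gt0 g1 g2; rewrite addrAC in g1 *.
by field; rewrite !gt_eqF.
Qed.

(** The integrand is nonnegative and its integral was computed to be finite. *)
Lemma RL_integrable_powR (R : realType) (r p x : R) : 0 < r -> 0 < p -> 0 < x ->
  (@lebesgue_measure R).-integrable `[0%R, x]
    (fun y => (RL_integrand r (fun y => y `^ p) x y)%:E).
Proof.
move=> r0 p0 x0; apply/integrableP; split.
  apply/measurable_EFinP/measurable_funTS/measurable_funM => //.
  by apply: (measurableT_comp (@measurable_powR R (r - 1))); exact: measurable_funB.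
under eq_integral do rewrite gee0_abs ?lee_fin ?mulr_ge0 ?powR_ge0//.
by rewrite RL_integrand_powR// ltry.
Qed.

(** Taking [q = p + (k - s)] gives [q - k = p - s], so the choice of [k] disappears from the result.
    The exponent [p - s] may be negative, as long as it exceeds -1. *)
Lemma RL_powR (R : realType) (k : nat) (s p : R) :
  s < k%:R -> 0 < p -> 0 < p - s + 1 ->
  RL_derivable k s (fun x => x `^ p) /\
  forall x : R, 0 < x -> RL_deriv k s (fun x => x `^ p) x =
    Gamma (p + 1) / Gamma (p - s + 1) * x `^ (p - s).
Proof.
move=> sk p0 ps.
have r0 : 0 < k%:R - s by lra.
have E : p + (k%:R - s) - k%:R = p - s by ring.
have qk : 0 < p + (k%:R - s) - k%:R + 1 by rewrite E.
have H := @derive1n_powR R (RL_integral (k%:R - s) (fun x => x `^ p)) (@Gamma R)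
  (Gamma (p + 1)) (p + (k%:R - s)) k
  (fun x x0 => RL_integral_powR _ _ _ _ r0 p0 x0)
  (@GammaS R) (@Gamma_gt0 R) qk.
split=> [x x0|x x0].
  split; first exact: RL_integrable_powR.
  by move=> j jk; exact: (H j (ltnW jk) x x0).2.
by rewrite /RL_deriv (H k (leqnn k) x x0).1 E.
Qed.

Theorem mainTheorem8 (R : realType) (k m : nat)
    (hk : (expR 1 : R) < k%:R) (hm : (pi : R) < m%:R) :
  let e : R := expR 1 in
  let p : R := pi in
  [/\ RL_derivable k e (fun x => x `^ p),
      RL_derivable m p (fun x => x `^ e) &
      forall x : R, 0 < x ->
        [/\ RL_deriv k e (fun x => x `^ p) x
              = Gamma (p + 1) / Gamma (p - e + 1) * x `^ (p - e),
            RL_deriv m p (fun x => x `^ e) x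
              = Gamma (e + 1) / Gamma (e - p + 1) * x `^ (e - p) &
            RL_deriv k e (fun x => x `^ p) x * RL_deriv m p (fun x => x `^ e) x
              = (Gamma (p + 1) * Gamma (e + 1))
                / (Gamma (p - e + 1) * Gamma (e - p + 1))]].
Proof.
move=> e p.
have e52 : 5 / 2 < e := expR1_gt52 R.
have e3 : e < 3 := expR1_lt3 R.
have p72 : p < 7 / 2 := pi_lt72 R.
have p2 : 2 <= p := pi_ge2 R.
(* The bounds give [p - e > 2 - 3] and [e - p > 5/2 - 7/2], so both exponents exceed -1. *)
have [||d1 D1] := @RL_powR R k e p hk; try lra.
have [||d2 D2] := @RL_powR R m p e hm; try lra.
split=> // x x0; rewrite D1// D2//; split=> //.
(* The two powers of [x] are mutually inverse, so the product loses its dependence on [x]. *)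
have -> : x `^ (e - p) = (x `^ (p - e))^-1 by rewrite -powRN opprB.
have gpe : 0 < Gamma (p - e + 1) by apply: Gamma_gt0; lra.
have gep : 0 < Gamma (e - p + 1) by apply: Gamma_gt0; lra.
by field; rewrite !gt_eqF// powR_gt0.
Qed.
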